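(* Let $X$ be the one-dimensional torus system. Let $V_n$, $n\in\mathbb{N}$, and $V$ be potentials such that $V_n\to V$ in $L^1$ and $V\ge v_{\min}$ for some constant $v_{\min}>0$. Then there is a constant $C>0$, depending only on $\mathbb{E}[V]$ and $v_{\min}$, and there is $n_0\in\mathbb{N}$ such that for all $n\ge n_0$ and all $y\in\mathbb{R}$, $$|\Gamma_{V_n}^2(y)-\Gamma_V^2(y)|\le C\,\|V_n-V\|_1\,|y|^2.$$
   Context: The $d$-dimensional torus system is $(\Omega,\mathcal{F},\mathbb{P},\tau)$ with $\Omega=\mathbb{T}^d$ the $d$-dimensional torus $\mathbb{R}^d/\mathbb{Z}^d$, $\mathcal{F}$ its Borel $\sigma$-algebra, $\mathbb{P}$ the Lebesgue (probability) measure and $\tau_x\omega:=\omega+x\ (\mathrm{mod}\ 1)$ for $x\in\mathbb{R}^d$; here $d=1$. $\mathbb{E}$ is expectation w.r.t. $\mathbb{P}$, $L^p=L^p(\Omega,\mathcal{F},\mathbb{P})$. A potential is a nonnegative $V\in L^1$. For measurable $f$ on $\Omega$ put $f_\omega(x):=f(\tau_x\omega)$. If $f_\omega$ is differentiable for all $\omega$, put $(Df)(\omega):=D(f_\omega)(0)$; $D^nf$, $\nabla f$ and $\nabla\cdot\phi$ are defined in the same way. Let $\mathbb{F}$ be the set of $f\in L^1$ such that $\mathbb{E}f=1$, there is $c_f>0$ with $f\ge c_f$, $f_\omega$ is differentiable of any order for all $\omega$, and $\sup_\Omega|D^nf|<\infty$ for all $n\in\mathbb{N}_0$. For $y\in\mathbb{R}^d$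 let $\Phi_y$ be the set of $\phi\in(L^1)^d$ such that $\phi_\omega$ is differentiable of any order for all $\omega$, $\sup_\Omega|D^n\phi|<\infty$ for all $n\in\mathbb{N}_0$, $\mathbb{E}\phi=y$, and $\nabla\cdot\phi=0$ for all $\omega$. Define $$\Gamma_V(y):=2\inf_{f\in\mathbb{F}}\left[\left(\int\frac{|\nabla f|^2}{8f}+Vf\,d\mathbb{P}\right)\left(\inf_{\phi\in\Phi_y}\int\frac{|\phi|^2}{2f}\,d\mathbb{P}\right)\right]^{1/2},$$ and $\Gamma_V^2(y):=(\Gamma_V(y))^2$. *)

(* Defs.v *)
From HB Require Import structures.
From mathcomp Require Import all_boot all_order all_algebra.
From mathcomp Require Import all_classical all_reals all_analysis measurable_realfun.

Set Implicit Arguments.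
Unset Strict Implicit.
Unset Printing Implicit Defensive.

Import Order.TTheory GRing.Theory Num.Theory.
Import numFieldNormedType.Exports.

Local Open Scope classical_set_scope.
Local Open Scope ring_scope.
Local Open Scope quotient_scope.

Section torus_type.
Variable R : realType.

Definition int_subgroup : zmodClosed R := (@Num.int_num_subdef R : {pred R}).

(** [{ideal_quot _}] only uses the additive structure: this is the quotient
    group R / Z. *)
Definition circle : Type := quotient_topology {ideal_quot int_subgroup}.

HB.instance Definition _ := GRing.Zmodule.copy circle {ideal_quot int_subgroup}.
HB.instance Definition _ :=
  Topological.copy circle (quotient_topology {ideal_quot int_subgroup}).
HB.instance Definition _ := isPointed.Build circle 0.

(** The quotient R / Z with its Borel sigma-algebra. *)
Definition torus : Type := g_sigma_algebraType [set U : set circle | open U].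

HB.instance Definition _ := Measurable.on torus.
HB.instance Definition _ := GRing.Zmodule.copy torus circle.

Definition torus_proj (x : R) : torus := \pi_({ideal_quot int_subgroup}) x.

Lemma torus_projD (x y : R) : torus_proj (x + y) = torus_proj x + torus_proj y.
Proof. exact: Quotient.pi_add. Qed.

Lemma torus_proj_eq (x y : R) :
  torus_proj x = torus_proj y <-> x - y \is a Num.int.
Proof.
split => [/eqP|xy]; first by rewrite -(Quotient.idealrBE int_subgroup).
by apply/eqP; rewrite -(Quotient.idealrBE int_subgroup).
Qed.

Lemma torus_proj_surj (w : torus) : exists x, torus_proj x = w.
Proof. by exists (repr (w : {ideal_quot int_subgroup})); exact: reprK. Qed.

Lemma measurable_torus_proj :
  measurable_fun (setT : set (measurableTypeR R)) torus_proj.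
Proof.
apply: (measurability (rT := torus) [set U : set circle | open U]) => //.
move=> _ [U oU <-]; rewrite setTI.
by apply: open_measurable; exact: oU.
Qed.

(** Lebesgue measure on R / Z: the image of Lebesgue measure on [[0, 1]], whose
    endpoints are identified but form a null set. *)
Definition torus_prob : set torus -> \bar R :=
  pushforward (uniform_prob (@ltr01 R)) torus_proj.

Let torus_prob0 : torus_prob set0 = 0%E.
Proof. by have mproj := measurable_torus_proj; exact: measure0. Qed.

Let torus_prob_ge0 (A : set torus) : (0 <= torus_prob A)%E.
Proof. by have mproj := measurable_torus_proj; exact: measure_ge0. Qed.

Let torus_prob_sigma_additive : semi_sigma_additive torus_prob.
Proof. by have mproj := measurable_torus_proj; exact: measure_semi_sigma_additive. Qed.

HB.instance Definition _ := isMeasure.Build _ _ _ torus_prob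
  torus_prob0 torus_prob_ge0 torus_prob_sigma_additive.

Let torus_probT : torus_prob [set: torus] = 1%E.
Proof.
by rewrite /torus_prob /pushforward preimage_setT probability_setT.
Qed.

HB.instance Definition _ :=
  Measure_isProbability.Build _ _ _ torus_prob torus_probT.

End torus_type.

Section torus_system.
Variable R : realType.
Local Notation Omega := (torus R).
Local Notation P := (@torus_prob R).
Implicit Types (f phi V : Omega -> R) (w : Omega) (x y : R).

Definition tau x w : Omega := w + torus_proj x.

Definition orbit_fun f w : R -> R := fun x => f (tau x w).

(** [Dn n f] is D^n f; in dimension one [Dn 1 f] is at the same time the
    gradient and the divergence of [f]. *)
Definition Dn (n : nat) f : Omega -> R := fun w => derive1n n (orbit_fun f w) 0.

Definition smooth_on_orbits f : Prop :=
  forall w (n : nat) x, derivable (derive1n n (orbit_fun f w)) x 1.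

Definition bounded_derivatives f : Prop :=
  forall n : nat, exists M : R, forall w, `|Dn n f w| <= M.

Definition L1norm f : R := fine ('N[P]_1[EFin \o f])%E.

(** Elements of L^1 are represented by functions, so that inequalities
    between them are meant almost everywhere. *)
Definition potential V : Prop :=
  V \in Lfun P 1 /\ {ae P, forall w, 0 <= V w}.

Definition bbF : set (Omega -> R) := [set f |
  [/\ f \in Lfun P 1,
      'E_P[f]%E = 1%E,
      (exists2 c : R, 0 < c & forall w, c <= f w),
      smooth_on_orbits f &
      bounded_derivatives f]].

Definition Phi y : set (Omega -> R) := [set phi |
  [/\ phi \in Lfun P 1,
      smooth_on_orbits phi,
      bounded_derivatives phi,
      'E_P[phi]%E = y%:E &
      forall w, Dn 1 phi w = 0]].

(** The real-valued integrals and infima below take no default value when [V]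
    is a potential: for [f] in [bbF] and [phi] in [Phi y] the integrands are
    integrable, and [bbF] and [Phi y] contain the constants 1 and [y]. *)
Definition energy V f : R :=
  \int[P]_w (`|Dn 1 f w| ^+ 2 / (8 * f w) + V w * f w).

Definition flow_cost f phi : R := \int[P]_w (`|phi w| ^+ 2 / (2 * f w)).

Definition Gamma V y : R :=
  2 * inf [set Num.sqrt (energy V f * inf [set flow_cost f phi | phi in Phi y])
          | f in bbF].

End torus_system.

(* Main.v *)
(** In dimension one a divergence-free field is constant, so [Phi y] is the
    singleton [{y}] and
      [Gamma V y ^+ 2 = 2 y^2 inf_f A_V(f) B(f)],
    where [A_V(f)] is the energy and [B(f) = E[1/f]].  Since [1/f >= 2 - f],
    [B(f) >= 1]; since [|f'| <= |f'|^2 / (8 f) + 2 f], the oscillation of [f]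
    is at most [A_V(f) + 2], hence [f <= 3 + A_V(f)].  On the competitors with
    [A_V(f) B(f) <= K] one therefore gets
      [|A_W(f) - A_V(f)| B(f) <= ||W - V||_1 (3 + K) B(f)],
    and [B(f)] is bounded there because [A_V >= v_min], or [A_(Vn) >= v_min / 2]
    when [n] is large. *)
Require Import Defs.
From mathcomp Require Import all_boot all_order all_algebra.
From mathcomp Require Import all_classical all_reals all_analysis measurable_realfun.
From mathcomp Require Import ring lra.
Import Order.TTheory GRing.Theory Num.Theory.
Import numFieldNormedType.Exports.
Local Open Scope classical_set_scope.
Local Open Scope ring_scope.

Set Implicit Arguments.
Unset Strict Implicit.
Unset Printing Implicit Defensive.

(** * Calculus on the circle through lifts to the real line, up to the oscillation bound *)

Section torus_calculus.
Variable R : realType.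
Local Notation P := (@torus_prob R).
Local Notation proj := (@torus_proj R).
Implicit Types (f g h : torus R -> R) (w : torus R) (x y : R).

Lemma torus_proj0 : proj 0 = 0.
Proof. by apply: (addrI (proj 0)); rewrite -torus_projD !addr0. Qed.

Lemma orbit_fun_proj f x : orbit_fun f (proj x) = fun t => f (proj (x + t)).
Proof. by apply/funext => t; rewrite /orbit_fun /tau torus_projD. Qed.

Lemma Dn0E f : Dn 0 f = f.
Proof. by apply/funext => w; rewrite /Dn /= /orbit_fun /tau torus_proj0 addr0. Qed.

(** The orbit through [proj x] is the lift [f \o proj] shifted by [x], so [Dn 1] becomes the
    ordinary derivative of a single function on the line. *)
Lemma Dn1_proj f x : Dn 1 f (proj x) = derive1 (f \o proj) x.
Proof.
rewrite /Dn orbit_fun_proj /= /derive1.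
by under eq_fun do rewrite addr0 (addrC x); rewrite /= addr0.
Qed.

Lemma smooth_derivable f : smooth_on_orbits f ->
  forall x, derivable (f \o proj) x 1.
Proof.
move=> /(_ 0 0%N) sf x; have := sf x.
by rewrite -torus_proj0 orbit_fun_proj /=; under eq_fun do rewrite add0r.
Qed.

Lemma smooth_derivable1 f : smooth_on_orbits f ->
  forall x, derivable (derive1 (f \o proj)) x 1.
Proof.
move=> /(_ 0 1%N) sf x; have := sf x.
by rewrite -torus_proj0 orbit_fun_proj /=; under eq_fun do rewrite add0r.
Qed.

Lemma smooth_continuous f : smooth_on_orbits f -> continuous (f \o proj).
Proof.
move=> sf x; apply: differentiable_continuous.
by apply/derivable1_diffP; exact: smooth_derivable.
Qed.

(** A set is open in the quotient topology as soon as its preimage under [proj] is open. Continuity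
    of the lift therefore puts preimages of open intervals among the generators of the Borel
    sigma-algebra. *)
Lemma measurable_torus_fun h : continuous (h \o proj) ->
  measurable_fun setT h.
Proof.
move=> /continuousP hc.
apply: (measurability _ (RGenOpens.measurableE R)) => _ [U [a [b ->]] <-].
rewrite setTI; apply: sub_sigma_algebra.
exact: (hc _ (interval_open _ _)).
Qed.

Lemma smooth_measurable f : smooth_on_orbits f -> measurable_fun setT f.
Proof.
by move=> sf; apply: measurable_torus_fun; exact: smooth_continuous.
Qed.

Lemma smooth_continuous1 f : smooth_on_orbits f ->
  continuous (derive1 (f \o proj)).
Proof.
move=> sf x; apply: differentiable_continuous.
by apply/derivable1_diffP; exact: smooth_derivable1.
Qed.

Lemma smooth_measurable1 f : smooth_on_orbits f -> measurable_fun setT (Dn 1 f).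
Proof.
move=> sf; apply: measurable_torus_fun.
rewrite (_ : _ \o _ = derive1 (f \o proj)); first exact: smooth_continuous1.
by apply/funext => x /=; exact: Dn1_proj.
Qed.

Lemma bounded_integrable h : measurable_fun setT h ->
  (exists M, forall w, `|h w| <= M) -> P.-integrable setT (EFin \o h).
Proof.
move=> mh [M hM]; apply: measurable_bounded_integrable => //.
  by rewrite (le_lt_trans (probability_le1 _ _)) ?ltry.
by exists M; split; [exact: num_real|move=> N MN w _; exact: le_trans (hM w) (ltW MN)].
Qed.

Lemma torus_proj_itv w : exists2 x, x \in `[0, 1] & w = proj x.
Proof.
have [x <-] := torus_proj_surj w.
exists (x - (Num.floor x)%:~R).
  have /andP[] := Num.Theory.floor_itv x.
  by rewrite in_itv/= subr_ge0 => -> /ltW; rewrite lerBlDl intrD.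
by apply/torus_proj_eq; rewrite opprB addrC subrK intr_int.
Qed.

Lemma Rintegral_torus h : measurable_fun setT h -> (forall w, 0 <= h w) ->
  \int[P]_w h w = \int[lebesgue_measure]_(x in `[0, 1]) h (proj x).
Proof.
move=> mh h0; congr fine.
have mp := @measurable_torus_proj R.
have -> : (\int[P]_w (h w)%:E = \int[uniform_prob (@ltr01 R)]_x (h (proj x))%:E)%E.
  rewrite (ge0_integral_pushforward mp)//=.
  - exact/measurable_EFinP.
  - by move=> w _; rewrite lee_fin.
rewrite integral_uniform//=.
- by rewrite subr0 invr1 mul1e.
- by apply/measurable_EFinP; exact: (measurableT_comp mh mp).
- by move=> x; rewrite lee_fin.
Qed.

(** Both points have representatives in [0, 1]. The fundamental theorem of calculus on the segment
    between them bounds the difference by the integral of |f'| over that segment, hence over the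
    whole circle. *)
Lemma smooth_osc f : smooth_on_orbits f ->
  forall w w', f w - f w' <= \int[P]_v `|Dn 1 f v|.
Proof.
move=> sf.
set I := \int[P]_v _.
have cg' := smooth_continuous1 sf.
have IE : I = \int[lebesgue_measure]_(x in `[0, 1]) `|derive1 (f \o proj) x|.
  have mf : measurable_fun setT (fun v => `|Dn 1 f v|).
    by apply: measurableT_comp => //; exact: smooth_measurable1.
  apply: etrans (Rintegral_torus mf (fun v => normr_ge0 _)) _.
  by apply: eq_Rintegral => x _; rewrite Dn1_proj.
have int01 a b : lebesgue_measure.-integrable `[a, b] (EFin \o (derive1 (f \o proj))).
  apply: continuous_compact_integrable; first exact: segment_compact.
  exact: continuous_subspaceT.
have osc a b : 0 <= a -> a <= b -> b <= 1 ->
    `|(f \o proj) b - (f \o proj) a| <= I.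
  (* The degenerate segment a = b is split off because [continuous_FTC2] needs a < b. *)
  move=> a0; rewrite le_eqVlt => /predU1P[<- _|ab b1].
    by rewrite subrr normr0; apply: Rintegral_ge0.
  have /(congr1 fine)/= <- : (\int[lebesgue_measure]_(x in `[a, b])
      (derive1 (f \o proj) x)%:E = ((f \o proj) b)%:E - ((f \o proj) a)%:E)%E.
    apply: continuous_FTC2 => //.
      exact: continuous_subspaceT.
    split=> [x _||].
    - exact: smooth_derivable.
    - apply: cvg_at_right_filter. exact: smooth_continuous.
    - apply: cvg_at_left_filter. exact: smooth_continuous.
  rewrite IE.
  apply: le_trans (le_normr_Rintegral _ (int01 _ _)) _ => //.
  apply: fine_le.
  - by apply: integrable_fin_num => //; exact: integrable_norm (int01 a b).
  - by apply: integrable_fin_num => //; exact: integrable_norm (int01 0 1).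
  - apply: ge0_subset_integral => //.
    + apply/measurable_EFinP; apply: measurableT_comp => //.
      by apply: subspace_continuous_measurable_fun => //; exact: continuous_subspaceT.
    + by move=> x /=; rewrite !in_itv/= => /andP[ax xb]; rewrite (le_trans a0)// (le_trans xb).
move=> w w'.
have [x + ->] := torus_proj_itv w; have [y + ->] := torus_proj_itv w'.
rewrite !in_itv/= => /andP[y0 y1] /andP[x0 x1].
have [xy|/ltW yx] := leP x y.
  by apply: le_trans (osc x y _ _ _) => //; rewrite distrC ler_norm.
by apply: le_trans (osc y x _ _ _) => //; rewrite ler_norm.
Qed.

End torus_calculus.

(** * Integrability and almost everywhere comparison for real-valued integrands *)

Section real_integrable.
Context d (T : measurableType d) (R : realType) (mu : {measure set T -> \bar R}).
Implicit Types f g : T -> R.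

Lemma integrableDr f g :
  mu.-integrable setT (EFin \o f) -> mu.-integrable setT (EFin \o g) ->
  mu.-integrable setT (EFin \o (fun x => f x + g x)).
Proof. by move=> fi gi; exact: (integrableD measurableT fi gi). Qed.

Lemma integrableBr f g :
  mu.-integrable setT (EFin \o f) -> mu.-integrable setT (EFin \o g) ->
  mu.-integrable setT (EFin \o (fun x => f x - g x)).
Proof. by move=> fi gi; exact: (integrableB measurableT fi gi). Qed.

Lemma integrableZlr (c : R) f : mu.-integrable setT (EFin \o f) ->
  mu.-integrable setT (EFin \o (fun x => c * f x)).
Proof. by move=> fi; exact: (integrableZl measurableT c fi). Qed.

Lemma integrableZrr (c : R) f : mu.-integrable setT (EFin \o f) ->
  mu.-integrable setT (EFin \o (fun x => f x * c)).
Proof. by move=> fi; exact: (integrableZr measurableT c fi). Qed.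

(** Needed because bounds on potentials hold only almost everywhere. The difference g - f agrees
    almost everywhere with |g - f|, whose integral is nonnegative. *)
Lemma ae_le_Rintegral f g :
  mu.-integrable setT (EFin \o f) -> mu.-integrable setT (EFin \o g) ->
  {ae mu, forall x, f x <= g x} -> \int[mu]_x f x <= \int[mu]_x g x.
Proof.
move=> fi gi fg.
have mf : measurable_fun setT f by exact/measurable_EFinP/(measurable_int mu).
have mg : measurable_fun setT g by exact/measurable_EFinP/(measurable_int mu).
have md : measurable_fun setT (g \- f) by exact: measurable_funB.
rewrite -subr_ge0 -RintegralB// /Rintegral.
rewrite (ae_eq_integral (fun x => (`|g x - f x|)%:E))//; first exact: Rintegral_ge0.
- exact/measurable_EFinP.
- by apply/measurable_EFinP; apply: measurableT_comp.
- by apply: filterS fg => x fgx _ /=; rewrite ger0_norm// subr_ge0.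
Qed.

End real_integrable.

(** * The classes [bbF] and [Phi], and bounds on the energy and on E[1/f] *)

Section torus_functionals.
Variable R : realType.
Local Notation P := (@torus_prob R).
Local Notation proj := (@torus_proj R).
Local Notation F := (@bbF R).
Implicit Types (f g h V W : torus R -> R) (w : torus R) (x y : R).

Lemma Dn_cst n (c : R) w : Dn n.+1 (cst c) w = 0.
Proof.
have cE k : derive1n k.+1 (cst c : R -> R) = cst 0.
  elim: k => [|k ih]; first by apply/funext => x /=; exact: derive1_cst.
  have := ih; rewrite /derive1n /= => ->.
  by apply/funext => x; exact: derive1_cst.
by rewrite /Dn (_ : orbit_fun _ _ = cst c)// cE.
Qed.

Lemma smooth_cst (c : R) : smooth_on_orbits (cst c : torus R -> R).
Proof.
move=> w n x; rewrite (_ : orbit_fun _ _ = cst c)//.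
suff [k ->] : exists k : R, derive1n n (cst c : R -> R) = cst k by exact: derivable_cst.
elim: n => [|n [k ih]]; first by exists c.
exists 0; have := ih; rewrite /derive1n /= => ->.
by apply/funext => t; exact: derive1_cst.
Qed.

Lemma bounded_derivatives_cst (c : R) : bounded_derivatives (cst c : torus R -> R).
Proof.
move=> [|n]; first by exists `|c| => w; rewrite Dn0E.
by exists 0 => w; rewrite Dn_cst normr0.
Qed.

Lemma Phi_cst y : Phi y = [set cst y : torus R -> R].
Proof.
apply/seteqP; split => [phi [_ sphi _ Ephi dphi]|_ ->] /=.
  have phiE : phi = cst (phi 0).
    (* The divergence is the derivative of the lift, which is thus constant on the line; the mean
       then forces the value y. *)
    apply/funext => w; have [x <-] := torus_proj_surj w.
    rewrite -torus_proj0.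
    apply: (is_derive_0_is_cst (f := phi \o proj) x 0) => t.
    apply: DeriveDef; first exact: smooth_derivable.
    by rewrite -derive1E -Dn1_proj.
  by move: Ephi; rewrite phiE expectation_cst => -[->].
split.
- exact: Lfun_cst.
- exact: smooth_cst.
- exact: bounded_derivatives_cst.
- exact: expectation_cst.
- by move=> w; rewrite Dn_cst.
Qed.

Lemma bbF1 : F (cst 1).
Proof.
split.
- exact: Lfun_cst.
- exact: expectation_cst.
- by exists 1.
- exact: smooth_cst.
- exact: bounded_derivatives_cst.
Qed.

Lemma bbF_gt0 f w : F f -> 0 < f w.
Proof. by case=> _ _ [c c0 cf] _ _; exact: lt_le_trans (cf w). Qed.

Lemma bbF_measurable f : F f -> measurable_fun setT f.
Proof. by case=> _ _ _ /smooth_measurable. Qed.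

Lemma bbF_bounded f : F f -> exists M, forall w, `|f w| <= M.
Proof.
by case=> _ _ _ _ /(_ 0%N)[M fM]; exists M => w; have := fM w; rewrite Dn0E.
Qed.

Lemma bbF_integrable f : F f -> P.-integrable setT (EFin \o f).
Proof. by case=> /Lfun1_integrable. Qed.

Lemma bbF_mean f : F f -> \int[P]_w f w = 1.
Proof. by case=> _; rewrite unlock /Rintegral => ->. Qed.

Lemma Rintegral_torus_cst (c : R) : \int[P]_w c = c.
Proof. by have := expectation_cst P c; rewrite unlock /Rintegral => ->. Qed.

Lemma torus_cst_integrable (c : R) : P.-integrable setT (EFin \o (fun=> c)).
Proof. by apply: bounded_integrable => //; exists `|c|. Qed.

Lemma measurable_inv_bbF f : F f -> measurable_fun setT (fun w => (f w)^-1).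
Proof.
move=> Ff; have [_ _ _ sf _] := Ff.
apply: measurable_torus_fun => x.
apply: (@continuousV _ _ (f \o proj)); first by rewrite gt_eqF// bbF_gt0.
exact: smooth_continuous.
Qed.

Lemma bbF_inv_bounded f : F f -> exists M, forall w, `|(f w)^-1| <= M.
Proof.
move=> Ff; have [_ _ [c c0 cf] _ _] := Ff; exists c^-1 => w.
have f0 := bbF_gt0 w Ff.
by rewrite gtr0_norm ?invr_gt0// lef_pV2 ?posrE.
Qed.

Lemma bbF_inv_integrable f : F f -> P.-integrable setT (EFin \o (fun w => (f w)^-1)).
Proof.
move=> Ff; apply: bounded_integrable; first exact: measurable_inv_bbF.
exact: bbF_inv_bounded.
Qed.

Lemma fisher_integrable f : F f ->
  P.-integrable setT (EFin \o (fun w => `|Dn 1 f w| ^+ 2 / (8 * f w))).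
Proof.
move=> Ff; have [_ _ _ sf bf] := Ff.
apply: bounded_integrable.
  rewrite (_ : (fun w => _) =
      ((fun w => `|Dn 1 f w| ^+ 2) \* (fun w => 8^-1 * (f w)^-1))); last first.
    by apply/funext => w /=; rewrite invfM.
  apply: measurable_funM; last first.
    by apply: measurable_funM => //; exact: measurable_inv_bbF.
  apply: measurable_funX.
  by apply: measurableT_comp => //; exact: smooth_measurable1.
have [M fM] := bf 1%N; have [N fN] := bbF_inv_bounded Ff.
exists (M ^+ 2 * (8^-1 * N)) => w.
rewrite normrM ler_pM// ?normrX ?normr_id.
  by rewrite lerXn2r// nnegrE (le_trans _ (fM w)).
by rewrite invfM normrM ler_pM// ger0_norm.
Qed.

Lemma potential_integrable V : potential V -> P.-integrable setT (EFin \o V).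
Proof. by case=> /Lfun1_integrable. Qed.

(** V is merely integrable, so it is the boundedness of f that makes the product integrable. *)
Lemma mul_bbF_integrable V f : P.-integrable setT (EFin \o V) -> F f ->
  P.-integrable setT (EFin \o (fun w => V w * f w)).
Proof.
move=> iV Ff; apply: (integrableMl measurableT iV (bbF_measurable Ff)).
have [M fM] := bbF_bounded Ff; exists M; split; first exact: num_real.
by move=> N MN w _; exact: le_trans (fM w) (ltW MN).
Qed.

Lemma energy_integrable V f : potential V -> F f ->
  P.-integrable setT (EFin \o (fun w => `|Dn 1 f w| ^+ 2 / (8 * f w) + V w * f w)).
Proof.
move=> pV Ff; exact: (integrableDr (fisher_integrable Ff)
  (mul_bbF_integrable (potential_integrable pV) Ff)).
Qed.

Lemma fisher_ge0 f w : F f -> 0 <= `|Dn 1 f w| ^+ 2 / (8 * f w).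
Proof. by move=> Ff; rewrite divr_ge0 ?sqr_ge0// mulr_ge0// ltW// bbF_gt0. Qed.

Lemma energy_lb V f (v : R) : potential V -> F f ->
  {ae P, forall w, v <= V w} -> v <= energy V f.
Proof.
move=> pV Ff vV; rewrite -[leLHS]mulr1 -(bbF_mean Ff) -RintegralZl//; last first.
  exact: bbF_integrable.
apply: ae_le_Rintegral; first exact: (integrableZlr _ (bbF_integrable Ff)).
  exact: energy_integrable.
apply: filterS vV => w vV; rewrite ler_wpDl ?fisher_ge0//.
by rewrite ler_wpM2r// ltW// bbF_gt0.
Qed.

Lemma energy1 V : energy V (cst 1) = \int[P]_w V w.
Proof.
by apply: eq_Rintegral => w _; rewrite Dn_cst normr0 expr0n/= mul0r add0r mulr1.
Qed.

(** The gradient terms of the two energies cancel, and what remains is (W - V) f <= |W - V| s. *)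
Lemma energy_perturb V W f (s : R) : potential V -> potential W -> F f ->
  (forall w, f w <= s) -> energy W f <= energy V f + L1norm (W \- V) * s.
Proof.
move=> pV pW Ff fs.
have iWV : P.-integrable setT (EFin \o (W \- V)).
  exact: (integrableBr (potential_integrable pW)
    (potential_integrable pV)).
have iN : P.-integrable setT (EFin \o (fun w => `|(W \- V) w|)).
  exact: (integrable_norm iWV).
have -> : L1norm (W \- V) = \int[P]_w `|(W \- V) w|.
  by rewrite /L1norm Lnorm1.
rewrite -RintegralZr// -RintegralD//; last first.
- exact: integrableZrr.
- exact: energy_integrable.
apply: le_Rintegral => //.
- exact: energy_integrable.
- apply: integrableDr => //; [exact: energy_integrable|exact: integrableZrr].
- move=> w _; rewrite -addrA lerD2l -lerBlDl -mulrBl.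
  apply: (@le_trans _ _ (`|W w - V w| * f w)).
    by rewrite ler_wpM2r ?ler_norm// ltW// bbF_gt0.
  by rewrite ler_wpM2l.
Qed.

Lemma bbF_sup V f w : potential V -> F f -> f w <= 3 + energy V f.
Proof.
move=> pV Ff; have [_ _ _ sf bf] := Ff.
have iD : P.-integrable setT (EFin \o (fun v => `|Dn 1 f v|)).
  apply: bounded_integrable.
    by apply: measurableT_comp => //; exact: smooth_measurable1.
  by have [M fM] := bf 1%N; exists M => v; rewrite normr_id.
have DE : \int[P]_v `|Dn 1 f v| <= energy V f + 2.
  (* The additive constant 2 is the integral of 2 f, as E f = 1; it absorbs the second term of the
     inequality below. *)
  have -> : 2 = \int[P]_v (2 * f v).
    by rewrite RintegralZl ?bbF_integrable// bbF_mean// mulr1.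
  rewrite -RintegralD//; last 2 first.
  - exact: energy_integrable.
  - exact: (integrableZlr _ (bbF_integrable Ff)).
  apply: ae_le_Rintegral => //.
    apply: integrableDr => //; first exact: energy_integrable.
    exact: (integrableZlr _ (bbF_integrable Ff)).
  apply: filterS pV.2 => v V0.
  have f0 := bbF_gt0 v Ff.
  (* AM-GM: |f'| <= |f'|^2 / (8 f) + 2 f *)
  apply: (@le_trans _ _ (`|Dn 1 f v| ^+ 2 / (8 * f v) + 2 * f v)); last first.
    by rewrite lerD2r lerDl mulr_ge0// ltW.
  rewrite -subr_ge0 (_ : _ - _ = (`|Dn 1 f v| - 4 * f v) ^+ 2 / (8 * f v)).
    by rewrite divr_ge0 ?sqr_ge0// mulr_ge0// ltW.
  by field; rewrite gt_eqF.
(* The bound f(w) <= f(v) + [energy V f] + 2, which follows from [smooth_osc], is averaged over v;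
   the mean of f supplies the remaining 1 of the constant 3. *)
have fw : f w <= \int[P]_v f v + (energy V f + 2).
  rewrite (_ : f w = \int[P]_v f w); last first.
    by rewrite Rintegral_torus_cst.
  rewrite (_ : energy V f + 2 = \int[P]_v (energy V f + 2)); last first.
    by rewrite Rintegral_torus_cst.
  rewrite -RintegralD//; last 2 first.
  - exact: bbF_integrable.
  - exact: torus_cst_integrable.
  apply: le_Rintegral => //; first exact: torus_cst_integrable.
    by apply: integrableDr => //; [exact: bbF_integrable|exact: torus_cst_integrable].
  by move=> v _; rewrite -lerBlDl; apply: le_trans (smooth_osc sf _ _) DE.
by apply: le_trans fw _; rewrite (bbF_mean Ff); lra.
Qed.

Lemma inv_mean_ge1 f : F f -> 1 <= \int[P]_w (f w)^-1.
Proof.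
move=> Ff.
(* 2 - t is the tangent line of 1/t at t = 1, and its mean along f is 1 because E f = 1. *)
have -> : 1 = \int[P]_w (2 - f w).
  rewrite RintegralB//; last 2 first.
  - exact: torus_cst_integrable.
  - exact: bbF_integrable.
  by rewrite (bbF_mean Ff) Rintegral_torus_cst; lra.
apply: le_Rintegral => //.
- by apply: integrableBr => //; [exact: torus_cst_integrable|exact: bbF_integrable].
- exact: bbF_inv_integrable.
move=> w _; have f0 := bbF_gt0 w Ff.
rewrite -subr_ge0 (_ : _ - _ = (f w - 1) ^+ 2 / f w).
  by rewrite divr_ge0 ?sqr_ge0// ltW.
by field; rewrite gt_eqF.
Qed.

Lemma inf_flow_cost f y : F f ->
  inf [set flow_cost f phi | phi in Phi y] = y ^+ 2 / 2 * \int[P]_w (f w)^-1.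
Proof.
move=> Ff; rewrite Phi_cst image_set1 inf1 /flow_cost -RintegralZl//; last first.
  exact: bbF_inv_integrable.
by apply: eq_Rintegral => w _ /=; rewrite real_normK ?num_real// invfM mulrA.
Qed.

End torus_functionals.

(** * [Gamma] squared as an infimum, and its one-sided perturbation *)

Section Gamma_comparison.
Variable R : realType.
Local Notation P := (@torus_prob R).
Local Notation F := (@bbF R).
Implicit Types (f V W : torus R -> R) (y : R).
Local Notation invmean f := (\int[P]_w (f w)^-1).

Lemma energy_ge0 V f : potential V -> F f -> 0 <= energy V f.
Proof. by move=> pV Ff; apply: energy_lb => //; exact: pV.2. Qed.

Lemma energy_flow_ge0 V f y : potential V -> F f ->
  0 <= energy V f * (y ^+ 2 / 2 * invmean f).
Proof.
move=> pV Ff; rewrite mulr_ge0 ?energy_ge0// mulr_ge0 ?divr_ge0 ?sqr_ge0//.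
exact: le_trans ler01 (inv_mean_ge1 Ff).
Qed.

(** With [le_Gamma_sqr] this says that the square of [Gamma V y] is the infimum of 2 y^2 A_V(f)
    B(f), so that later arguments avoid square roots. The factor is 2^2 times the 1/2 of the flow
    cost. *)
Lemma Gamma_sqr_le V f y : potential V -> F f ->
  Gamma V y ^+ 2 <= 2 * y ^+ 2 * (energy V f * invmean f).
Proof.
move=> pV Ff; have e0 := energy_flow_ge0 y pV Ff.
have G0 g : 0 <= Num.sqrt (energy V g * inf [set flow_cost g phi | phi in Phi y]).
  exact: sqrtr_ge0.
have -> : 2 * y ^+ 2 * (energy V f * invmean f) =
    (2 * Num.sqrt (energy V f * (y ^+ 2 / 2 * invmean f))) ^+ 2.
  by rewrite exprMn sqr_sqrtr//; field.
rewrite lerXn2r ?nnegrE ?mulr_ge0 ?sqrtr_ge0//.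
  by apply: lb_le_inf; [by eexists; exists f|move=> _ [g _ <-]].
rewrite ler_wpM2l//; apply: ge_inf; first by exists 0 => _ [g _ <-].
by exists f => //; rewrite inf_flow_cost.
Qed.

Lemma le_Gamma_sqr V y (m : R) : potential V ->
  (forall f, F f -> m <= 2 * y ^+ 2 * (energy V f * invmean f)) ->
  m <= Gamma V y ^+ 2.
Proof.
(* A negative m is below any square. Otherwise the square root of m is compared with [Gamma V y];
   the constant 1 shows that the infimum is over a nonempty set. *)
move=> pV mF; have [m0|m0] := ltP m 0.
  by rewrite (le_trans (ltW m0))// sqr_ge0.
rewrite -(sqr_sqrtr m0) lerXn2r ?nnegrE ?sqrtr_ge0//.
  apply: mulr_ge0 => //; apply: lb_le_inf => [|_ [g _ <-]]; last exact: sqrtr_ge0.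
  by eexists; exists (cst 1); first exact: bbF1.
rewrite -ler_pdivrMl//; apply: lb_le_inf.
  by eexists; exists (cst 1); first exact: bbF1.
move=> _ [f Ff <-]; rewrite inf_flow_cost// ler_pdivrMl//.
have e0 := energy_flow_ge0 y pV Ff.
rewrite -(@ler_pXn2r _ 2)// ?nnegrE ?mulr_ge0 ?sqrtr_ge0//.
rewrite sqr_sqrtr// exprMn sqr_sqrtr//; apply: le_trans (mF _ Ff) _.
by rewrite le_eqVlt; apply/orP; left; apply/eqP; field.
Qed.

(* A competitor for [V] whose value exceeds [K] is replaced by the constant 1,
   whose value for [W] is [E W <= K]. *)
Lemma Gamma_sqr_perturb V W y (K L : R) : potential V -> potential W ->
  \int[P]_w W w <= K -> 0 <= L ->
  (forall f, F f -> energy V f <= K -> energy V f * invmean f <= K ->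
    invmean f <= L) ->
  Gamma W y ^+ 2 <=
    Gamma V y ^+ 2 + 2 * y ^+ 2 * (L1norm (W \- V) * (3 + K) * L).
Proof.
move=> pV pW WK L0 HL; set D := L1norm _.
have K0 : 0 <= K by rewrite (le_trans _ WK)// -energy1 energy_ge0//; exact: bbF1.
have D0 : 0 <= D by rewrite fine_ge0// Lnorm_ge0.
have y0 : 0 <= 2 * y ^+ 2 by rewrite mulr_ge0// sqr_ge0.
have inv1 : invmean (cst 1 : torus R -> R) = 1.
  rewrite -[RHS](Rintegral_torus_cst 1); apply: eq_Rintegral => w _ /=; exact: invr1.
have W1 : Gamma W y ^+ 2 <= 2 * y ^+ 2 * K.
  apply: le_trans (Gamma_sqr_le y pW (@bbF1 R)) _.
  by rewrite energy1 inv1 mulr1 ler_wpM2l.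
rewrite -lerBlDr; apply: le_Gamma_sqr => // f Ff.
have B1 := inv_mean_ge1 Ff.
rewrite lerBlDr -mulrDr.
have A0 := energy_ge0 pV Ff.
have [VK|/ltW KV] := leP (energy V f * invmean f) K.
  (* Since B(f) >= 1, the bound on the product also bounds the energy, and with it the supremum of
     f. *)
  have AK : energy V f <= K by apply: le_trans VK; rewrite ler_peMr.
  have BL := HL _ Ff AK VK.
  apply: le_trans (Gamma_sqr_le y pW Ff) _; rewrite ler_wpM2l//.
  have fs w : f w <= 3 + K by apply: le_trans (bbF_sup w pV Ff) _; rewrite lerD2l.
  have := energy_perturb pV pW Ff fs; rewrite -/D => EW.
  apply: (@le_trans _ _ ((energy V f + D * (3 + K)) * invmean f)).
    by rewrite ler_wpM2r// (le_trans ler01).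
  by rewrite mulrDl lerD2l ler_wpM2l// mulr_ge0// addr_ge0.
apply: le_trans W1 _; rewrite ler_wpM2l// (le_trans KV)// lerDl.
by rewrite !mulr_ge0// addr_ge0.
Qed.

Lemma L1normC V W : L1norm (V \- W) = L1norm (W \- V).
Proof.
by rewrite /L1norm !Lnorm1; congr fine; apply: eq_integral => w _; rewrite /= distrC.
Qed.

End Gamma_comparison.

(** * Lipschitz dependence of the squared [Gamma] on the potential: constants and the two
    inequalities *)

Theorem theorem4p6 (R : realType) (EV v_min : R) (v_min_gt0 : 0 < v_min) :
  exists2 C : R, 0 < C &
    forall (Vn : nat -> torus R -> R) (V : torus R -> R),
      (forall n : nat, potential (Vn n)) ->
      potential V ->
      L1norm (Vn n \- V) @[n --> \oo] --> 0 ->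
      {ae @torus_prob R, forall w, v_min <= V w} ->
      ('E_(@torus_prob R)[V])%E = EV%:E ->
      exists n0 : nat, forall n : nat, (n0 <= n)%N -> forall y : R,
        `|Gamma (Vn n) y ^+ 2 - Gamma V y ^+ 2| <=
          C * L1norm (Vn n \- V) * `|y| ^+ 2.
Proof.
(* K bounds E[V], and also E[Vn] once the L^1 distance is at most 1; the absolute value makes it
   positive before any V is given. L is the bound on B(f) that follows from A(f) B(f) <= K and A(f)
   >= v_min / 2. *)
pose K := `|EV| + 1; pose L := 2 * K / v_min.
have K0 : 0 < K by rewrite ltr_wpDl.
have K3 : 0 < 3 + K by rewrite addr_gt0.
have L0 : 0 < L by rewrite divr_gt0// mulr_gt0.
exists (2 * ((3 + K) * L)); first by apply: mulr_gt0 => //; apply: mulr_gt0.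
move=> Vn V pVn pV cVn V_min EVE.
have EV_int : \int[@torus_prob R]_w V w = EV by move: EVE; rewrite unlock /Rintegral => ->.
(* Distance at most 1 gives E[Vn] <= K. The second entry keeps the loss of energy at most v_min / 2
   on functions bounded by 3 + K. *)
pose e := Num.min 1 (v_min / 2 / (3 + K)).
have e0 : 0 < e by rewrite lt_min ltr01 !divr_gt0.
have [n0 _ n0P] : \forall n \near \oo, L1norm (Vn n \- V) <= e.
  move/cvgr0Pnorm_le : cVn => /(_ _ e0); apply: filterS => n.
  exact: le_trans (ler_norm _).
exists n0 => n /n0P; rewrite /= le_min => /andP[D1 Dv] y.
have {}Dv : L1norm (Vn n \- V) * (3 + K) <= v_min / 2.
  by rewrite -ler_pdivlMr.
(* Stated with v_min / 2 so that it serves both V and Vn. *)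
have bound W f : bbF f -> v_min / 2 <= energy W f ->
    energy W f * \int[@torus_prob R]_w (f w)^-1 <= K ->
    \int[@torus_prob R]_w (f w)^-1 <= L.
  move=> Ff vW WK; rewrite ler_pdivlMr// mulrC -ler_pdivrMl// mulrA.
  apply: le_trans WK; rewrite ler_wpM2r//; last by rewrite mulrC.
  exact: le_trans (inv_mean_ge1 Ff).
(* The energy at the constant 1 is the mean of the potential, so [energy_perturb] with s = 1
   compares the two means. *)
have VnK : \int[@torus_prob R]_w Vn n w <= K.
  rewrite -energy1; apply: le_trans (energy_perturb (s := 1) pV (pVn n) (@bbF1 R) _) _ => //.
  by rewrite energy1 EV_int mulr1 lerD// ler_norm.
have VK : \int[@torus_prob R]_w V w <= K.
  by rewrite EV_int (le_trans (ler_norm _))// lerDl.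
have le1 := Gamma_sqr_perturb (L := L) y pV (pVn n) VnK (ltW L0).
have le2 := Gamma_sqr_perturb (L := L) y (pVn n) pV VK (ltW L0).
rewrite real_normK ?num_real// ler_distl; apply/andP; split.
  (* Here the competitors are those of Vn, for which no lower bound is assumed. As f <= 3 + K, the
     bound v_min on the energy of V passes to Vn with loss at most v_min / 2. *)
  rewrite lerBlDr; apply: le_trans (le2 _) _ => [f Ff EK|].
    apply: bound => //.
    have fs w : f w <= 3 + K.
      by apply: le_trans (bbF_sup w (pVn n) Ff) _; rewrite lerD2l.
    have := energy_perturb (pVn n) pV Ff fs; rewrite L1normC.
    have := energy_lb pV Ff V_min.
    lra.
  by rewrite L1normC lerD2l le_eqVlt; apply/orP; left; apply/eqP; ring.
(* Here the competitors are those of V, whose energy is at least v_min. *)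
apply: le_trans (le1 _) _ => [f Ff EK|].
  apply: bound => //.
  have := energy_lb pV Ff V_min.
  lra.
by rewrite lerD2l le_eqVlt; apply/orP; left; apply/eqP; ring.
Qed.
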